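(* There are positive absolute constants $c_2,c_3$ such that the following holds. Let $n\ge1$ and $1\le k\le n$ be integers, $G=\mathbb Z_2^n$, $q=2^n$, $\alpha=k/(2n)$ and $\beta=-(\alpha\log_2\alpha+(1-\alpha)\log_2(1-\alpha))$. Then \[ \lambda(B_k)\ge c_2\alpha^{1/4}\left(\alpha^\alpha(1-\alpha)^{1-\alpha}\right)^n=c_2\alpha^{1/4}q^{-\beta},\qquad \lambda(A_k)\le c_3\alpha^{-1/4}q^{\beta-1}. \]
   Context: Elements of $G=\mathbb Z_2^n$ are $0$-$1$ sequences of length $n$; the norm $\|x\|$ is the number of coordinates of $x$ equal to $1$. The ball is $B_k=\{x\in G:\|x\|\le k\}$ and the antiball is $A_k=\{x\in G:\|x\|>k\}\cup\{0\}$. A character of $G$ is a homomorphism $\gamma:G\to\{z\in\mathbb C:|z|=1\}$; $\hat G$ is the group of characters and $\mathbf 1$ the principal character. For $f:G\to\mathbb R$, $\hat f(\gamma)=\sum_{x\in G}\gamma(x)f(x)$. For a set $A\subset G$ with $A=-A$, $0\in A$, let $\mathcal S(A)$ be the set of $f:G\to\mathbb R$, not identically zero, with $f=0$ on $G\setminus A$, and $\lambda(A)=\min\{f(0)/\hat f(\mathbf 1): f\in\mathcal S(A),\ \hat f(\gamma)\ge0\ \forall\gamma\in\hat G\}$. *)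

(* Defs.v *)
From HB Require Import structures.
From mathcomp Require Import all_boot all_order all_algebra.
From mathcomp Require Import all_classical all_reals all_analysis.
From mathcomp Require Import complex.

Set Implicit Arguments.
Unset Strict Implicit.
Unset Printing Implicit Defensive.

Import Order.TTheory GRing.Theory Num.Theory.
Import numFieldNormedType.Exports.

Local Open Scope classical_set_scope.
Local Open Scope ring_scope.
Local Open Scope complex_scope.

Section Lambda.
Variables (R : realType) (G : finZmodType).

Definition is_character (g : G -> R[i]) : Prop :=
  (forall x y, g (x + y) = g x * g y) /\ (forall x, `|g x| = 1).

Definition principal_character : G -> R[i] := fun=> 1.

Definition fourier (f : G -> R) (g : G -> R[i]) : R[i] :=
  \sum_x g x * (f x)%:C.

Definition nonzero_supported_on (A : {set G}) (f : G -> R) : Prop :=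
  (exists x, f x != 0) /\ (forall x, x \notin A -> f x = 0).

(* [0 <= z] on [R[i]] means that z is real and nonnegative. A function whose
   transform vanishes at the principal character gives the ratio f(0)/0 = +oo
   (as f(0) > 0), so it does not take part in the minimum; it has to be
   excluded explicitly since division by zero returns 0. *)
Definition lambda_ratios (A : {set G}) : set R :=
  [set l | exists f : G -> R,
    [/\ nonzero_supported_on A f,
        forall g, is_character g -> 0 <= fourier f g,
        fourier f principal_character != 0 &
        l%:C = (f 0)%:C / fourier f principal_character]].

(* The infimum is a minimum: see [lambda_min] below. *)
Definition lambda (A : {set G}) : R := inf (lambda_ratios A).

End Lambda.

Notation cube n := 'rV['Z_2]_n.

Definition cube_norm (n : nat) (x : cube n) : nat := #|[set i | x 0 i == 1]%SET|.

Definition cube_ball (n k : nat) : {set cube n} :=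
  [set x | (cube_norm x <= k)%N]%SET.

Definition cube_antiball (n k : nat) : {set cube n} :=
  ([set x | (k < cube_norm x)%N] :|: [set 0])%SET.

Definition log2 (R : realType) (x : R) : R := ln x / ln 2.

Lemma cube_oppE n (x : cube n) : - x = x.
Proof.
by apply/rowP => i; rewrite mxE; case: (x 0 i) => -[|[|//]] ?; apply/val_inj.
Qed.

Lemma cube_norm0 n : cube_norm (0 : cube n) = 0%N.
Proof. by apply/eqP; rewrite cards_eq0; apply/eqP/setP => i; rewrite !inE mxE. Qed.

Lemma cube_ball0 n k : 0 \in cube_ball n k.
Proof. by rewrite inE cube_norm0. Qed.

Lemma cube_antiball0 n k : 0 \in cube_antiball n k.
Proof. by rewrite !inE eqxx orbT. Qed.

Section LambdaMin.
Variables (R : realType) (n : nat).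
Local Notation G := (cube n).

Let s (a b : 'Z_2) : R[i] := if (a == 1) && (b == 1) then -1 else 1.
Let chi (a x : G) : R[i] := \prod_i s (a 0 i) (x 0 i).

Let sD a b c : s a (b + c) = s a b * s a c.
Proof.
rewrite /s; case: a => -[|[|//]] ?; case: b => -[|[|//]] ?;
  case: c => -[|[|//]] ? /=; by rewrite -?val_eqE /= ?(mulr1, mul1r, mulrNN).
Qed.

Let chi_char a : is_character (chi a).
Proof.
split=> [x y|x].
  by rewrite -big_split; apply: eq_bigr => i _ /=; rewrite mxE sD.
rewrite normr_prod big1 // => i _.
by rewrite /s; case: ifP => _; rewrite ?normrN normr1.
Qed.

Let sum_chi (x : G) : \sum_a chi a x = (2 ^+ n) *+ (x == 0).
Proof.
have -> : \sum_a chi a x = \prod_i \sum_(b : 'Z_2) s b (x 0 i).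
  rewrite bigA_distr_bigA /=.
  rewrite (reindex (fun f : {ffun 'I_n -> 'Z_2} => \row_i f i)) /=.
    by apply: eq_bigr => f _; apply: eq_bigr => i _; rewrite mxE.
  exists (fun a : G => [ffun i => a 0 i]) => [f _|a _].
    by apply/ffunP => i; rewrite ffunE mxE.
  by apply/rowP => i; rewrite mxE ffunE.
have [->|xN0] := eqVneq x 0.
  rewrite (eq_bigr (fun=> 2)) ?prodr_const ?card_ord // => i _.
  by rewrite mxE big_ord_recl big_ord1 /s -!val_eqE.
have [i xi] : exists i, x 0 i != 0 by apply/rV0Pn.
rewrite (bigD1 i) //= big_ord_recl big_ord1 /s.
have -> : x 0 i == 1.
  by move: xi; case: (x 0 i) => -[|[|//]] ?; rewrite -!val_eqE.
by rewrite -!val_eqE /= subrr mul0r.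
Qed.

Let inversion (f : G -> R) x :
  \sum_a chi a x * fourier f (chi a) = 2 ^+ n * (f x)%:C.
Proof.
under eq_bigr do rewrite /fourier big_distrr /=.
rewrite exchange_big /= (bigD1 x) //= [X in _ + X]big1 => [|y yx].
  under eq_bigr do rewrite mulrA -(chi_char _).1.
  by rewrite addr0 -big_distrl /= sum_chi -[X in X + x]cube_oppE addNr eqxx.
under eq_bigr do rewrite mulrA -(chi_char _).1.
rewrite -big_distrl /= sum_chi -[X in X + y]cube_oppE addrC subr_eq0.
by rewrite (negPf yx) mul0r.
Qed.

Let nonneg (f : G -> R) := forall g, is_character g -> 0 <= fourier f g.

Let normr_le0 (f : G -> R) x : nonneg f -> `|f x| <= f 0.
Proof.
move=> pf; have q0 : 0 < 2 ^+ n :> R[i] by rewrite exprn_gt0.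
rewrite -lecR -(ler_pM2l q0) -(inversion f 0).
have -> : (`|f x|)%:C = `|(f x)%:C| by rewrite normc_def /= expr0n addr0 sqrtr_sqr.
rewrite -[X in X * _](ger0_norm (ltW q0)) -normrM -inversion.
apply: le_trans (ler_norm_sum _ _ _) _; apply: ler_sum => a _.
rewrite normrM (chi_char _).2 mul1r ger0_norm ?pf //.
suff -> : chi a 0 = 1 by rewrite mul1r.
by rewrite /chi big1 // => i _; rewrite mxE /s -[0 == 1]val_eqE andbF.
Qed.

Let principal_is_character : is_character (@principal_character R G).
Proof. by split=> *; rewrite /principal_character ?mulr1 ?normr1. Qed.

Let fourier1 (f : G -> R) :
  fourier f (@principal_character R G) = (\sum_x f x)%:C.
Proof. by rewrite /fourier rmorph_sum; apply: eq_bigr => x _; rewrite mul1r. Qed.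

Let ReIm_fourier (f : G -> R) g :
  fourier f g = (\sum_x complex.Re (g x) * f x) +i*
                (\sum_x complex.Im (g x) * f x).
Proof.
rewrite /fourier; elim/big_rec3: _ => // x a b c _ ->.
by case: (g x) => u v; apply/eqP; rewrite eq_complex /= !mulr0 subr0 add0r !eqxx.
Qed.

Let fv (v : 'rV[R]_#|G|) (x : G) : R := v 0 (enum_rank x).

Let fv_cont (c : G -> R) : continuous (fun v => (\sum_x c x * fv v x) : R).
Proof.
move=> v; elim: (index_enum _) => [|x r IHr].
  rewrite (_ : (fun _ => _) = cst 0); first exact: cst_continuous.
  by apply/funext => w; rewrite big_nil.
rewrite (_ : (fun _ => _) =
    (fun w => c x * fv w x) \+ (fun w => \sum_(y <- r) c y * fv w y)); last first.
  by apply/funext => w; rewrite big_cons.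
apply: continuousD => //; apply: continuousM; first exact: cst_continuous.
exact: coord_continuous.
Qed.

Let attained (A : {set G}) : 0 \in A ->
  exists2 l, lambda_ratios (R := R) A l & lbound (lambda_ratios (R := R) A) l.
Proof.
move=> A0.
pose K : set 'rV[R]_#|G| := [set v | fv v 0 = 1 /\
  (forall x, x \notin A -> fv v x = 0) /\ nonneg (fv v)].
have K0 : K (\row_i (enum_val i == 0)%:R).
  have E x : fv (\row_i (enum_val i == 0)%:R) x = (x == 0)%:R.
    by rewrite /fv mxE enum_rankK.
  split; first by rewrite E eqxx.
  split=> [x xA|g [gD gN]]; first by rewrite E; case: eqVneq xA => // ->; rewrite A0.
  rewrite /fourier (bigD1 0) //= big1 => [|x x0]; last first.
    by rewrite E (negPf x0) mulr0.
  rewrite E eqxx addr0 mulr1; suff -> : g 0 = 1 by [].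
  have g0 : g 0 != 0 by rewrite -normr_gt0 gN.
  by apply: (mulfI g0); rewrite -gD addr0 mulr1.
have Kcl : closed K.
  have -> : K = [set v | fv v 0 = 1] `&`
     (\bigcap_(x in [set x | x \notin A]) [set v | fv v x = 0] `&`
      \bigcap_(g in [set g | is_character g])
        ([set v | \sum_x complex.Im (g x) * fv v x = 0] `&`
         [set v | 0 <= \sum_x complex.Re (g x) * fv v x])).
    apply/seteqP; split=> v /=.
      move=> [v0 [vA vp]]; split=> //; split=> // g gc.
      by move: (vp g gc); rewrite ReIm_fourier lecE /= => /andP[/eqP-> ->].
    move=> [v0 [vA vp]]; split=> //; split=> // g gc.
    by rewrite ReIm_fourier lecE /=; have [/= -> ->] := vp g gc; rewrite eqxx.
  have cc x : continuous (fv^~ x) by move=> v; exact: coord_continuous.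
  apply: closedI; first by apply: (preimage_closed _ (@closed_eq R 1)) => v _; exact: cc.
  apply: closedI; [apply: closed_bigI => x _|apply: closed_bigI => g _].
    by apply: (preimage_closed _ (@closed_eq R 0)) => v _; exact: cc.
  apply: closedI.
    by apply: (preimage_closed _ (@closed_eq R 0)) => v _; exact: fv_cont.
  by apply: (preimage_closed _ (@closed_ge R 0)) => v _; exact: fv_cont.
have Kb : bounded_set K.
  exists 1; split; first exact: real1.
  move=> M M1 v [v0 [vA vp]] /=.
  rewrite [leLHS]/Num.norm /= mx_normrE; apply: bigmax_le.
    by apply: ltW; exact: lt_trans M1.
  move=> [i j] _ /=; rewrite (ord1 i) -(enum_valK j).
  by apply: le_trans (ltW M1); rewrite -v0; exact: normr_le0.
have [] := @EVT_max_rV R _ (fun v => \sum_x 1 * fv v x) K _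
  (bounded_closed_compact Kb Kcl).
- by exists (\row_i (enum_val i == 0)%:R).
- by apply: continuous_subspaceT; exact: fv_cont.
move=> v /set_mem Kv vmax.
have S1 : 1 <= \sum_x 1 * fv v x.
  apply: le_trans (vmax _ (mem_set K0)).
  rewrite (bigD1 0) //= big1 ?addr0 => [|x x0].
    by rewrite /fv mxE enum_rankK eqxx mul1r.
  by rewrite /fv mxE enum_rankK (negPf x0) mulr0.
have S0 : 0 < \sum_x 1 * fv v x by apply: lt_le_trans S1.
have SE : \sum_x 1 * fv v x = \sum_x fv v x by apply: eq_bigr => x _; rewrite mul1r.
have [v0 [vA vp]] := Kv.
exists (\sum_x 1 * fv v x)^-1.
  exists (fv v); split=> //.
  - by split=> //; exists 0; rewrite v0 oner_eq0.
  - by rewrite fourier1 -SE fmorph_eq0 gt_eqF.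
  - by rewrite fourier1 v0 SE div1r fmorphV.
move=> l [f [[[x0 fx0] fA] fp fN0 lE]].
have f0 : 0 < f 0 by apply: lt_le_trans (normr_le0 x0 fp); rewrite normr_gt0.
have Sf : 0 < \sum_x f x.
  move: fN0 (fp _ principal_is_character); rewrite fourier1 fmorph_eq0 lecR.
  by rewrite le0r => /negPf ->.
have {lE} -> : l = f 0 / \sum_x f x.
  by apply: complexI; rewrite lE fourier1 rmorphM fmorphV.
pose w : 'rV[R]_#|G| := \row_i ((f 0)^-1 * f (enum_val i)).
have wE x : fv w x = (f 0)^-1 * f x by rewrite /fv mxE enum_rankK.
have Kw : K w.
  split; first by rewrite wE mulVf ?gt_eqF.
  split=> [x xA|g gc]; first by rewrite wE (fA _ xA) mulr0.
  rewrite /fourier.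
  under eq_bigr do rewrite wE rmorphM mulrCA.
  by rewrite -big_distrr /= mulr_ge0 ?fp // lecR invr_ge0 ltW.
have := vmax _ (mem_set Kw).
under eq_bigr do rewrite wE mul1r.
rewrite -big_distrr /= => H.
rewrite -[leRHS]invrK lef_pV2 ?posrE ?invr_gt0 ?divr_gt0 //.
by rewrite invfM invrK.
Qed.

Lemma lambda_min (A : {set G}) : 0 \in A ->
  lambda_ratios A (lambda R A) /\
  (forall l, lambda_ratios A l -> lambda R A <= l).
Proof.
move=> /attained[l lA lb].
suff -> : lambda R A = l by [].
apply/eqP; rewrite eq_le; apply/andP; split.
  by apply: ge_inf => //; exists l.
by apply: lb_le_inf => //; exists l.
Qed.

End LambdaMin.

(* Main.v *)
(* By weak linear programming duality, a function [h] supported on the antiball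
   A_k with [h 0 = M] and transform at least [q] at the principal character and
   at least [0] elsewhere gives both [lambda B_k >= 1 / M] and
   [lambda A_k <= M / q].  We construct such an [h] with [M = 2 q^beta].

   For z = b (1/w - w) / (1 - b^2) on the unit circle |w| = 1, z is imaginary,
   1 + z = (1 + b/w) (1 - b w) / (1 - b^2), and z = 1 at w = b.  Evaluating
   w^k p(z(w)) E(w) at w = b (dropping the negative powers of w) is therefore a
   linear functional which sends every p of degree at most k to b^k E(b) p(1),
   and which is bounded by the l2 norm of the coefficients.  On the polynomials
   (1 + z)^(n-j) (1 - z)^j that arise from the characters, this norm does not
   depend on j, since |1 + b/w| = |1 + b w|.  With E close to
   1 / ((1 - b w) (1 - b^2 w^2)^n) the bound is b^-k (1 + b^2)^n up to a
   factor 2, which equals q^beta for b^2 = alpha / (1 - alpha).  The function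
   [h x] is then M delta_0 + 1 minus the normalised value of the functional at
   p = z^|x|; below everything is multiplied by w^n to stay in polynomials. *)
Require Import Defs.
From HB Require Import structures.
From mathcomp Require Import all_boot all_order all_algebra.
From mathcomp Require Import all_classical all_reals all_analysis.
From mathcomp Require Import complex ring lra.

Import Order.TTheory GRing.Theory Num.Theory.
Local Open Scope ring_scope.

(** * Square norms of polynomial coefficients *)

Section PolySquareNorm.
Variable F : realFieldType.
Implicit Types (p q : {poly F}) (c t : F).

Definition sqnorm p : F := \sum_(i < size p) p`_i ^+ 2.

Lemma sqnorm_wide m p : (size p <= m)%N -> sqnorm p = \sum_(i < m) p`_i ^+ 2.
Proof.
move=> pm; rewrite /sqnorm -!(big_mkord xpredT (fun i => p`_i ^+ 2)).
rewrite [RHS](@big_cat_nat _ _ _ (size p)) //= [X in _ + X]big_nat_cond.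
rewrite [X in _ + X]big1 ?addr0 //.
by move=> i /andP[/andP[pi _] _]; rewrite nth_default // expr0n.
Qed.

Lemma sqnormXnM m p : sqnorm ('X^m * p) = sqnorm p.
Proof.
rewrite (@sqnorm_wide (m + size p)) ?big_split_ord /=; last first.
  by rewrite (leq_trans (size_polyMleq _ _)) // size_polyXn.
rewrite big1 ?add0r => [|i _]; last by rewrite coefXnM ltn_ord expr0n.
by apply: eq_bigr => i _; rewrite coefXnM ltnNge leq_addr /= addKn.
Qed.

Lemma size_deg1M c d p : (size ((c%:P + d *: 'X) * p)%R <= (size p).+1)%N.
Proof.
apply: leq_trans (size_polyMleq _ _) _.
have : (size (c%:P + d *: 'X)%R <= 2)%N.
  apply: leq_trans (size_polyD _ _) _; rewrite geq_max.
  rewrite (leq_trans (size_polyC_leq1 _)) //=.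
  by rewrite (leq_trans (size_scale_leq _ _)) ?size_polyX.
by move=> h; rewrite -subn1 leq_subLR add1n -add2n leq_add2r.
Qed.

(* [X + c] and its reversal [1 + c X] have equal modulus on the unit circle. *)
Lemma sqnorm_reflect c p :
  sqnorm (('X + c%:P) * p) = sqnorm ((1 + c *: 'X) * p).
Proof.
have -> : 'X + c%:P = c%:P + 1 *: 'X :> {poly F} by rewrite scale1r addrC.
rewrite -[1 in RHS]polyC1 !(@sqnorm_wide (size p).+1) ?size_deg1M //.
apply/eqP; rewrite -subr_eq0 -sumrB; apply/eqP.
(* The [i]-th difference of squares is [(c^2 - 1) (p_i^2 - p_(i-1)^2)], so the sum telescopes. *)
pose f i := (c ^+ 2 - 1) * (if i is j.+1 then p`_j ^+ 2 else 0).
rewrite -(big_mkord xpredT (fun i => ((c%:P + 1 *: 'X) * p)`_i ^+ 2 -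
   ((1%:P + c *: 'X) * p)`_i ^+ 2)).
rewrite (eq_bigr (fun i => f i.+1 - f i)) => [|i _].
  rewrite telescope_sumr // /f.
  by rewrite nth_default // expr0n /= !mulr0 subrr.
rewrite !mulrDl !coefD -!scalerAl !coefZ !coefCM !coefXM /f.
by case: i => [|i] /=; ring.
Qed.

(** Triangle inequality for the l2 norm, which a shift preserves; coefficientwise the gap is
    [t (u + v)^2]. *)
Lemma sqnorm_subXnM t m p : 0 <= t ->
  sqnorm ((1 - t *: 'X^m) * p) <= (1 + t) ^+ 2 * sqnorm p.
Proof.
move=> t0; pose s := (m + size p)%N.
have s1 : (size p <= s)%N by exact: leq_addl.
have s2 : (size ('X^m * p)%R <= s)%N.
  by rewrite (leq_trans (size_polyMleq _ _)) // size_polyXn.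
have E : (1 - t *: 'X^m) * p = p - t *: ('X^m * p).
  by rewrite mulrBl mul1r scalerAl.
have s3 : (size ((1 - t *: 'X^m) * p)%R <= s)%N.
  rewrite E (leq_trans (size_polyD _ _)) // geq_max s1 size_polyN.
  exact: leq_trans (size_scale_leq _ _) s2.
have -> : (1 + t) ^+ 2 * sqnorm p =
    (1 + t) * sqnorm p + (1 + t) * t * sqnorm ('X^m * p).
  by rewrite sqnormXnM; ring.
rewrite (sqnorm_wide _ _ s3) {1}(sqnorm_wide _ _ s1) (sqnorm_wide _ _ s2).
rewrite !big_distrr -big_split /= ler_sum // => i _.
rewrite E coefB coefZ; set u := p`_i; set v := ('X^m * p)`_i.
have := mulr_ge0 t0 (sqr_ge0 (u + v)); rewrite !expr2; nra.
Qed.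

(** The hypothesis covers every cofactor [q], so the factors can be exchanged one at a time. *)
Lemma sqnorm_prod_reflect (I : Type) (r : seq I) (A B : I -> {poly F}) p :
  (forall i q, sqnorm (A i * q) = sqnorm (B i * q)) ->
  sqnorm (\prod_(i <- r) A i * p) = sqnorm (\prod_(i <- r) B i * p).
Proof.
move=> AB; elim: r p => [|i r IHr] p; first by rewrite !big_nil.
by rewrite !big_cons -!mulrA AB mulrCA IHr mulrCA.
Qed.

Lemma geometric_sum_le (x : F) m : 0 <= x < 1 -> \sum_(i < m) x ^+ i <= (1 - x)^-1.
Proof.
move=> /andP[x0 x1]; rewrite -[leRHS]mul1r ler_pdivlMr ?subr_gt0 //.
by rewrite mulrC -opprB mulNr -subrX1 opprB gerBl exprn_ge0.
Qed.

(* The functional [p |-> (drop_poly m p).[b]] is pairing with the sequence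
   [b^i] shifted by [m], whose square norm is at most [1 / (1 - b^2)]. *)
Lemma horner_drop_poly_le (b W : F) m p : 0 <= b < 1 -> 0 < W ->
  sqnorm p <= W ^+ 2 / (1 - b ^+ 2) ->
  (drop_poly m p).[b] <= W / (1 - b ^+ 2).
Proof.
move=> /andP[b0 b1] W0 pW.
have b21 : 0 <= b ^+ 2 < 1 by rewrite sqr_ge0 expr_lt1.
set s := (1 - b ^+ 2)^-1 in pW *.
(* Weighted AM-GM; the weight makes each of the two sums at most [W / (1 - b^2)]. *)
have H (x y : F) : 2 * (x * y) <= W^-1 * x ^+ 2 + W * y ^+ 2.
  have := mulr_ge0 (ltW W0) (sqr_ge0 (W^-1 * x - y)).
  suff -> : W * (W^-1 * x - y) ^+ 2 =
      W^-1 * x ^+ 2 + W * y ^+ 2 - 2 * (x * y) by rewrite subr_ge0.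
  by field; exact: lt0r_neq0.
rewrite -(ler_pM2l (ltr0n F 2)) horner_coef big_distrr /=.
apply: le_trans (ler_sum _ (fun i _ => H _ _)) _.
rewrite big_split -!big_distrr /=.
have d : \sum_(i < size (drop_poly m p)) (drop_poly m p)`_i ^+ 2 <= sqnorm p.
  rewrite size_drop_poly (@sqnorm_wide (m + (size p - m))) -?leq_subLR //.
  rewrite big_split_ord /= -[leLHS]add0r lerD ?sumr_ge0 // => [i _|].
    exact: sqr_ge0.
  by apply: ler_sum => i _; rewrite coef_drop_poly addnC.
have g : \sum_(i < size (drop_poly m p)) (b ^+ i) ^+ 2 <= s.
  under eq_bigr do rewrite exprAC.
  exact: geometric_sum_le.
have Wi : 0 <= W^-1 by rewrite invr_ge0 ltW.
have := lerD (ler_wpM2l Wi (le_trans d pW)) (ler_wpM2l (ltW W0) g).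
move=> /le_trans; apply; rewrite le_eqVlt; apply/orP; left; apply/eqP.
by rewrite expr2; field; exact: lt0r_neq0.
Qed.

End PolySquareNorm.

(** * Characters of the cube and duality *)

Lemma Z2P (a : 'Z_2) : a = if a == 1 then 1 else 0.
Proof. by case: a => -[|[|//]] ?; rewrite -val_eqE /=; apply: val_inj. Qed.

Lemma sum_cube_prod (S : comNzRingType) n (F : 'I_n -> 'Z_2 -> S) :
  \sum_(x : cube n) \prod_i F i (x 0 i) = \prod_i (F i 0 + F i 1).
Proof.
transitivity (\prod_i \sum_(b : 'Z_2) F i b); last first.
  apply: eq_bigr => i _; rewrite big_ord_recl big_ord1.
  by congr (F i _ + F i _); apply: val_inj.
rewrite bigA_distr_bigA /= (reindex (fun f : {ffun 'I_n -> 'Z_2} => \row_i f i)).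
  by apply: eq_bigr => f _; apply: eq_bigr => i _; rewrite mxE.
exists (fun x : cube n => [ffun i => x 0 i]) => [f _|x _].
  by apply/ffunP => i; rewrite ffunE mxE.
by apply/rowP => i; rewrite mxE ffunE.
Qed.

Section CubeCharacters.
Variables (R : realType) (n : nat).
Implicit Types (a x y : cube n) (f h : cube n -> R).

(** The character [(-1)^(a.x)], real valued so that duality can be argued over [R]. *)
Definition cube_char a x : R :=
  \prod_i (if (a 0 i == 1) && (x 0 i == 1) then -1 else 1).

Lemma cube_charC a x : cube_char a x = cube_char x a.
Proof. by apply: eq_bigr => i _; rewrite andbC. Qed.

Lemma cube_char0 x : cube_char 0 x = 1.
Proof. by apply: big1 => i _; rewrite mxE. Qed.

Lemma cube_charDr a x y :
  cube_char a (x + y) = cube_char a x * cube_char a y.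
Proof.
rewrite -big_split; apply: eq_bigr => i _ /=; rewrite mxE.
rewrite (Z2P (x 0 i)) (Z2P (y 0 i)); case: (a 0 i == 1) => /=; last by rewrite mulr1.
by case: (x 0 i == 1); case: (y 0 i == 1); rewrite -!val_eqE /= ?(mulr1, mul1r, mulrNN).
Qed.

Lemma sum_cube_char x : \sum_a cube_char a x = 2 ^+ n *+ (x == 0).
Proof.
rewrite (sum_cube_prod _ _ (fun i b => if (b == 1) && (x 0 i == 1) then -1 else 1)).
have [->|/rV0Pn[i xi]] := eqVneq x 0.
  rewrite (eq_bigr (fun=> 2)) ?prodr_const ?card_ord // => i _.
  by rewrite mxE.
rewrite (bigD1 i) //=; move: xi; rewrite (Z2P (x 0 i)); case: (x 0 i == 1) => // _.
by rewrite /= addrN mul0r.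
Qed.

Definition cube_fourier f a : R := \sum_x cube_char a x * f x.

Lemma cube_plancherel f h :
  \sum_a cube_fourier f a * cube_fourier h a = 2 ^+ n * \sum_x f x * h x.
Proof.
transitivity (\sum_x \sum_y f x * h y * \sum_a cube_char a (x + y)).
  under eq_bigr do rewrite /cube_fourier big_distrlr /=.
  rewrite exchange_big /=; apply: eq_bigr => x _.
  rewrite exchange_big /=; apply: eq_bigr => y _.
  by rewrite big_distrr; apply: eq_bigr => a _; rewrite /= cube_charDr mulrACA mulrC.
rewrite [RHS]big_distrr; apply: eq_bigr => x _ /=.
rewrite (bigD1 x) //= [X in _ + X]big1 => [|y yx]; rewrite sum_cube_char -[X in X + _ == 0]cube_oppE.
  by rewrite addNr eqxx addr0 mulr1n mulrC.
by rewrite addrC subr_eq0 (negPf yx) mulr0.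
Qed.

Local Open Scope complex_scope.

Lemma cube_char_is_character a : is_character (fun x => (cube_char a x)%:C).
Proof.
split=> [x y|x]; first by rewrite cube_charDr rmorphM.
rewrite rmorph_prod normr_prod big1 // => i _.
by case: ifP => _; rewrite ?rmorphN ?normrN rmorph1 normr1.
Qed.

(** A character is determined by its values on the unit vectors, which are [1] or [-1] because
    [2 e_i = 0]. *)
Lemma is_characterE (g : cube n -> R[i]) : is_character g ->
  exists a, g = fun x => (cube_char a x)%:C.
Proof.
move=> [gD gN].
have gN0 x : g x != 0 by rewrite -normr_gt0 gN.
have g0 : g 0 = 1 by apply: (mulfI (gN0 0)); rewrite -gD addr0 mulr1.
pose e i : cube n := delta_mx 0 i.
have ge i : g (e i) = if g (e i) == 1 then 1 else -1.
  have : g (e i) ^+ 2 == 1 by rewrite expr2 -gD -[X in X + _]cube_oppE addNr g0.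
  by rewrite sqrf_eq1; case: (g _ =P 1) => // _ /= /eqP.
exists (\row_i (if g (e i) == 1 then 0 else 1)); apply/funext => x.
rewrite {1}[x]row_sum_delta (big_morph g gD g0) rmorph_prod; apply: eq_bigr => i _.
rewrite mxE (Z2P (x 0 i)); case: (x 0 i == 1); last by rewrite scale0r g0 andbF.
rewrite scale1r [LHS]ge; case: (g _ == 1) => //=.
by rewrite rmorphN rmorph1.
Qed.

Lemma fourier_cube_char f a :
  fourier f (fun x => (cube_char a x)%:C) = (cube_fourier f a)%:C.
Proof. by rewrite rmorph_sum; apply: eq_bigr => x _; rewrite rmorphM. Qed.

Lemma principal_characterE :
  @principal_character R (cube n) = fun x => (cube_char 0 x)%:C.
Proof. by apply/funext => x; rewrite cube_char0. Qed.

(** Replaces complex transforms at all characters by real ones indexed by the cube. *)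
Lemma lambda_ratiosP (A : {set cube n}) l : lambda_ratios A l <->
  exists f, [/\ nonzero_supported_on A f, forall a, 0 <= cube_fourier f a,
    cube_fourier f 0 != 0 & l = f 0 / cube_fourier f 0].
Proof.
split=> -[f [fA fp f0 lE]]; exists f; split=> //.
- by move=> a; rewrite -lecR -fourier_cube_char; apply/fp/cube_char_is_character.
- by move: f0; rewrite principal_characterE fourier_cube_char fmorph_eq0.
- apply: complexI; rewrite lE principal_characterE fourier_cube_char.
  by rewrite rmorphM fmorphV.
- by move=> g /is_characterE[a ->]; rewrite fourier_cube_char lecR.
- by rewrite principal_characterE fourier_cube_char fmorph_eq0.
- by rewrite lE principal_characterE fourier_cube_char rmorphM fmorphV.
Qed.

(* The easy half of linear programming duality. *)
Lemma lambda_ball_antiball k h (M : R) : 0 < M -> h 0 = M ->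
  (forall x, x \notin cube_antiball n k -> h x = 0) ->
  (forall a, 2 ^+ n *+ (a == 0) <= cube_fourier h a) ->
  M^-1 <= lambda R (cube_ball n k) /\
  lambda R (cube_antiball n k) <= M / 2 ^+ n.
Proof.
move=> M0 h0 hA hp; have q0 : 0 < 2 ^+ n :> R by rewrite exprn_gt0.
have hp0 a : 0 <= cube_fourier h a.
  by apply: le_trans (hp a); rewrite mulrn_wge0 // ltW.
have := hp 0; rewrite eqxx mulr1n => hq; split.
  have [/lambda_ratiosP[f [[_ fB] fp f0 ->]] _] := lambda_min R (cube_ball0 n k).
  have {}f0 : 0 < cube_fourier f 0 by rewrite lt0r f0 fp.
  (* The ball and the antiball meet only in [0]. *)
  have E : \sum_x f x * h x = f 0 * M.
    rewrite (bigD1 0) //= h0 big1 ?addr0 // => x x0.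
    have [xk|xk] := leqP (cube_norm x) k.
      by rewrite hA ?mulr0 // !inE (negPf x0) orbF -leqNgt.
    by rewrite fB ?mul0r // inE -ltnNge.
  rewrite ler_pdivlMr // mulrC ler_pdivrMr // -(ler_pM2l q0) -E -[leRHS]cube_plancherel.
  (* All Plancherel terms are nonnegative, so the sum is at least its term at [a = 0]. *)
  rewrite (bigD1 0) //= -[leLHS]addr0 lerD // ?sumr_ge0 // => [|a _].
    by rewrite mulrC ler_pM2l.
  exact: mulr_ge0.
have h00 : 0 < cube_fourier h 0 by exact: lt_le_trans hq.
have [_ le_l] := lambda_min R (cube_antiball0 n k).
(* [h] itself competes in the minimum for the antiball. *)
apply: le_trans (le_l (h 0 / cube_fourier h 0) _) _.
  apply/lambda_ratiosP; exists h; split=> //; last by rewrite gt_eqF.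
  by split=> //; exists 0; rewrite h0 gt_eqF.
by rewrite h0 ler_pM2l // lef_pV2.
Qed.

End CubeCharacters.

(** * Construction of the function on the antiball *)

Section AntiballWitness.
Variables (R : realType) (n : nat).
Implicit Types (a x : cube n).

Lemma prod_cube_norm (Y Z : {poly R}) x :
  Y ^+ cube_norm x * Z ^+ (n - cube_norm x) =
  \prod_i (if x 0 i == 1 then Y else Z).
Proof.
rewrite (bigID (fun i => x 0 i == 1)) /=.
rewrite (eq_bigr (fun=> Y)) => [|i ->] //.
rewrite [X in _ = _ * X](eq_bigr (fun=> Z)) => [|i /negPf ->] //.
rewrite !prodr_const /cube_norm cardsE; congr (_ * Z ^+ _).
by rewrite -[X in (X - _)%N](card_ord n) -(cardC (fun i => x 0 i == 1)) addKn.
Qed.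

(** Character and summand are both products over the coordinates, so the sum factors (MacWilliams
    transform). *)
Lemma sum_cube_char_norm (Y Z : {poly R}) a :
  \sum_x cube_char R n a x *: (Y ^+ cube_norm x * Z ^+ (n - cube_norm x)) =
  \prod_i (Z + (if a 0 i == 1 then -1 else 1) *: Y).
Proof.
pose F i (c : 'Z_2) : {poly R} :=
  (if (a 0 i == 1) && (c == 1) then -1 else 1) *: (if c == 1 then Y else Z).
transitivity (\sum_(x : cube n) \prod_i F i (x 0 i)).
  apply: eq_bigr => x _; rewrite prod_cube_norm -mul_polyC rmorph_prod -big_split.
  by apply: eq_bigr => i _; rewrite /= mul_polyC.
rewrite sum_cube_prod; apply: eq_bigr => i _; rewrite /F !eqxx andbT.
by rewrite (_ : (0 == 1 :> 'Z_2) = false) // andbF scale1r.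
Qed.

Lemma bernoulli_ineq (t : R) m : 0 <= t <= 1 -> 1 - m%:R * t <= (1 - t) ^+ m.
Proof.
move=> /andP[t0 t1]; elim: m => [|m IHm]; first by rewrite mul0r subr0.
rewrite exprS -natr1; apply: le_trans (ler_wpM2l _ IHm); last by rewrite subr_ge0.
have := mulr_ge0 (mulr_ge0 (ler0n R m) t0) t0; nra.
Qed.

Lemma expr_small (b e : R) : 0 <= b < 1 -> 0 < e -> exists m, b ^+ m <= e.
Proof.
move=> /andP[b0 b1] e0; have : `|b| < 1 by rewrite ger0_norm.
move=> /cvg_expr/cvgrPdist_le/(_ e e0)[N _ /(_ N (leqnn N))] /=.
by rewrite sub0r normrN ger0_norm ?exprn_ge0 // => H; exists N.
Qed.

(* The polynomial E approximates [((1 - b X) (1 - b^2 X^2)^n)^-1]. *)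
Lemma antiball_witness k (b M : R) : (k <= n)%N -> 0 < b < 1 ->
  2 * (1 + b ^+ 2) ^+ n <= M * b ^+ k ->
  exists h : cube n -> R, [/\ h 0 = M,
    forall x, x \notin cube_antiball n k -> h x = 0 &
    forall a, 2 ^+ n *+ (a == 0) <= cube_fourier R n h a].
Proof.
move=> kn /andP[b0 b1] hM.
have b2 : 0 < 1 - b ^+ 2 by rewrite subr_gt0 expr_lt1 // ltW.
(* With [t] at most this bound, Bernoulli gives [(1 - t)^(n+1) >= 1/2], which accounts for the
   factor 2 in [hM]. *)
have n1 : 0 < (2 * n.+1%:R)^-1 :> R by rewrite invr_gt0 mulr_gt0 ?ltr0n.
have [|L hL] := @expr_small (b ^+ 2) _ _ n1; first by rewrite ltW ?exprn_gt0 // -subr_gt0.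
set t := b ^+ 2 ^+ L in hL.
have t0 : 0 <= t by rewrite !exprn_ge0 // ltW.
have tn : n.+1%:R * t <= 2^-1.
  rewrite mulrC -ler_pdivlMr ?ltr0n //.
  by apply: le_trans hL _; rewrite invfM.
have t1 : t <= 2^-1.
  apply: le_trans tn; rewrite -[leLHS]mul1r ler_wpM2r // ler1n //.
have tb : 2^-1 <= (1 - t) ^+ n.+1.
  apply: le_trans (bernoulli_ineq _ _ _); last by apply/andP; split; lra.
  lra.
(* Geometric series cut at length [L]: the errors in [(1 - b^2) G1(b)] and [(1 - b^2 X^2) G2] are
   [t] and [t X^(2L)]. *)
pose G1 : {poly R} := \poly_(i < L) b ^+ i.
pose G2 : {poly R} := \sum_(i < L) (b ^+ 2 *: 'X^2) ^+ i.
pose E := G1 * G2 ^+ n.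
have G2E : (1 - b ^+ 2 *: 'X^2) * G2 = 1 - t *: 'X^(2 * L).
  by rewrite -opprB mulNr -subrX1 opprB exprZn [in RHS]exprM.
have G1b : (1 - b ^+ 2) * G1.[b] = 1 - t.
  rewrite horner_poly -opprB mulNr.
  under eq_bigr do rewrite -expr2 exprAC.
  by rewrite -subrX1 opprB.
have G2b : (1 + b ^+ 2) * ((1 - b ^+ 2) * G2.[b]) = (1 - t) * (1 + t).
  have H : (1 - b ^+ 2 * b ^+ 2) * G2.[b] = 1 - t * t.
    have /= := congr1 (horner^~ b) G2E.
    rewrite hornerM !(hornerD, hornerN, hornerZ, hornerXn).
    by rewrite -!polyC1 !hornerC exprM.
  by transitivity (1 - t * t); [rewrite -H|]; ring.
have v0 : 0 < (1 - b ^+ 2) * G2.[b].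
  have : 0 < (1 + b ^+ 2) * ((1 - b ^+ 2) * G2.[b]) by rewrite G2b; nra.
  by rewrite pmulr_rgt0 // ltr_wpDr // sqr_ge0.
(* The value that the functional takes at every [x] of the ball, used to normalise it. *)
pose D := (1 - b ^+ 2) ^+ n * (b ^+ k * E.[b]).
have DE : (1 - b ^+ 2) * D = b ^+ k * (1 - t) * ((1 - b ^+ 2) * G2.[b]) ^+ n.
  by rewrite /D /E hornerM horner_exp -G1b exprMn; ring.
have D0 : 0 < D.
  rewrite -(pmulr_rgt0 _ b2) DE mulr_gt0 ?exprn_gt0 // mulr_gt0 ?exprn_gt0 //.
  lra.
have MD : (1 + t) ^+ n / (1 - b ^+ 2) <= M * D.
  have c0 : 0 < (1 + b ^+ 2) ^+ n by rewrite exprn_gt0 // ltr_wpDr // sqr_ge0.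
  rewrite ler_pdivrMr // -mulrA [D * _]mulrC DE -(ler_pM2l c0).
  have -> : (1 + b ^+ 2) ^+ n * (M * (b ^+ k * (1 - t) *
      ((1 - b ^+ 2) * G2.[b]) ^+ n)) = M * b ^+ k * (1 - t) ^+ n.+1 * (1 + t) ^+ n.
    transitivity (M * b ^+ k * (1 - t) * ((1 + b ^+ 2) * ((1 - b ^+ 2) * G2.[b])) ^+ n).
      by rewrite [in RHS]exprMn; ring.
    by rewrite G2b exprMn exprS; ring.
  apply: ler_wpM2r; first by rewrite exprn_ge0 // addr_ge0.
  have Mb : 0 <= M * b ^+ k by apply: le_trans hM; rewrite mulr_ge0 // ltW.
  apply: le_trans (ler_wpM2l Mb tb).
  by rewrite ler_pdivlMr // mulrC.
(* With [w = X], [Y / Z] is z and [U x] is [w^k z^|x| E] times [Z^n]; dropping coefficients below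
   [n] thus drops the negative powers of w. *)
pose Y : {poly R} := b *: (1 - 'X^2).
pose Z : {poly R} := (1 - b ^+ 2) *: 'X.
pose U x := 'X^k * E * (Y ^+ cube_norm x * Z ^+ (n - cube_norm x)).
pose h x := M * (x == 0)%:R + (1 - D^-1 * (drop_poly n (U x)).[b]).
(* Here [X^n] divides [U x], so no nonzero coefficient is dropped, and [Y] and [Z] agree at [b]. *)
have h1 x : (cube_norm x <= k)%N -> D^-1 * (drop_poly n (U x)).[b] = 1.
  move=> xk; suff -> : (drop_poly n (U x)).[b] = D by rewrite mulVf ?gt_eqF.
  set m := cube_norm x in xk *; have mn := leq_trans xk kn.
  have -> : U x = (((1 - b ^+ 2) ^+ (n - m) * b ^+ m) *: (1 - 'X^2) ^+ m *
      'X^(k - m) * E) * 'X^n.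
    rewrite /U -/m /Y /Z !exprZn -!mul_polyC.
    rewrite -[in 'X^k](subnK xk) -[in 'X^n](subnK mn) !exprD rmorphM /=.
    by ring.
  clearbody E; rewrite drop_polyMXn_id /D !(hornerM, hornerZ, horner_exp, hornerD, hornerN, hornerX).
  rewrite -polyC1 hornerC.
  rewrite -[in RHS](subnK mn) -[in RHS](subnK xk) !exprD.
  by ring.
exists h; split.
- by rewrite /h eqxx mulr1 h1 ?subrr ?addr0 // cube_norm0.
- move=> x; rewrite !inE negb_or -leqNgt => /andP[xk x0].
  by rewrite /h (negPf x0) mulr0 add0r h1 // subrr.
move=> a; pose S := \sum_x cube_char R n a x *: U x.
have -> : cube_fourier R n h a = 2 ^+ n *+ (a == 0) + (M - D^-1 * (drop_poly n S).[b]).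
  rewrite /cube_fourier /h; under eq_bigr do rewrite mulrDr mulrBr mulr1.
  rewrite big_split sumrB /=.
  under [X in _ + (X - _)]eq_bigr do rewrite cube_charC.
  rewrite sum_cube_char (bigD1 0) //= big1 => [|x /negPf ->]; last by rewrite !mulr0.
  rewrite eqxx !mulr1 addr0 cube_charC cube_char0 mul1r.
  have -> : (drop_poly n S).[b] = \sum_x cube_char R n a x * (drop_poly n (U x)).[b].
    rewrite /S linear_sum horner_sum; apply: eq_bigr => x _.
    by rewrite linearZ hornerZ.
  rewrite big_distrr /=; under [in RHS]eq_bigr do rewrite mulrCA.
  by rewrite addrCA.
rewrite lerDl subr_ge0 mulrC ler_pdivrMr //; apply: le_trans MD.
apply: horner_drop_poly_le; [by rewrite ltW| by rewrite exprn_gt0 // ltr_wpDr |].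
have -> : S = 'X^k * (\prod_i (Z + (if a 0 i == 1 then -1 else 1) *: Y) * E).
  rewrite -sum_cube_char_norm big_distrl big_distrr; apply: eq_bigr => x _ /=.
  by rewrite -scalerAl -scalerAr mulrA mulrAC.
(* Reflection makes each factor [1 - b^2 X^2], whatever [a] is; [G2] turns it into [1 - t X^(2L)],
   which costs [(1 + t)^2]. *)
rewrite sqnormXnM (sqnorm_prod_reflect _ _ _ _ (fun=> 1 - b ^+ 2 *: 'X^2)).
  rewrite prodr_const card_ord /E mulrCA -exprMn G2E mulrC.
  have G1n : sqnorm R G1 <= (1 - b ^+ 2)^-1.
    rewrite (sqnorm_wide _ L) ?size_poly //.
    under eq_bigr do rewrite coef_poly ltn_ord exprAC.
    by apply: geometric_sum_le; rewrite ltW ?exprn_gt0 // -subr_gt0.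
  elim: (n) => [|m IHm]; first by rewrite mul1r expr1n mul1r.
  rewrite exprS -mulrA; apply: le_trans (sqnorm_subXnM _ _ _ _ t0) _.
  rewrite [(1 + t) ^+ m.+1]exprS exprMn -[leRHS]mulrA; apply: ler_wpM2l; [exact: sqr_ge0|exact: IHm].
move=> i q; set s : R := if _ then _ else _.
have s2 : s * s = 1 by rewrite /s; case: ifP => _; rewrite ?mulrNN mulr1.
have s2P : s%:P * s%:P = 1 :> {poly R} by rewrite -polyCM s2.
(* Reversing [X + s b] leaves [(1 + s b X) (1 - s b X) = 1 - b^2 X^2], as [s^2 = 1]. *)
have -> : Z + s *: Y = ('X + (s * b)%:P) * (1 - (s * b) *: 'X).
  rewrite /Z /Y -!mul_polyC !(polyCM, polyCB, polyC1, rmorphXn) /=.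
  transitivity ((1 - s%:P * s%:P * b%:P ^+ 2) * 'X + s%:P * (b%:P * (1 - 'X^2))).
    by rewrite s2P mul1r.
  by ring.
rewrite -mulrA sqnorm_reflect mulrA; congr (sqnorm _ (_ * q)).
rewrite -!mul_polyC !(polyCM, rmorphXn) /=.
transitivity (1 - s%:P * s%:P * b%:P ^+ 2 * 'X^2 : {poly R}); last by rewrite s2P mul1r.
by ring.
Qed.

End AntiballWitness.

(** * Choice of b and the final bounds *)

Lemma lambda_cube_bounds (R : realType) n k (alpha : R) :
  (1 <= k <= n)%N -> alpha * (2 * n%:R) = k%:R ->
  let M := 2 * ((alpha `^ alpha * (1 - alpha) `^ (1 - alpha)) ^+ n)^-1 in
  M^-1 <= lambda R (cube_ball n k) /\ lambda R (cube_antiball n k) <= M / 2 ^+ n.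
Proof.
move=> /andP[k1 kn] ak M.
have n0 : 0 < n%:R :> R by rewrite ltr0n (leq_trans k1).
have a0 : 0 < alpha.
  have : 0 < k%:R :> R by rewrite ltr0n.
  by rewrite -ak pmulr_lgt0 // mulr_gt0.
have a1 : alpha <= 2^-1.
  have : (k%:R <= n%:R :> R) by rewrite ler_nat.
  rewrite -ak; nra.
have a1' : 0 < 1 - alpha by lra.
pose u := ln alpha; pose v := ln (1 - alpha).
have aE : alpha = expR u by rewrite lnK.
have vE : 1 - alpha = expR v by rewrite lnK.
have ME : M = 2 * expR (- (n%:R * (alpha * u + (1 - alpha) * v))).
  rewrite /M /powR !gt_eqF // -expRD -expRM_natl -expRN //.
have M0 : 0 < M by rewrite ME mulr_gt0 ?expR_gt0.
suff [h [h0 hA hp]] : exists h : cube n -> R, [/\ h 0 = M,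
    forall x, x \notin cube_antiball n k -> h x = 0 &
    forall a, 2 ^+ n *+ (a == 0) <= cube_fourier R n h a].
  exact: lambda_ball_antiball M0 h0 hA hp.
(* For [k = n] the choice below would give [b = 1], outside the range of [antiball_witness]; there
   [M = 2 * 2^n] and [M] times the delta at [0] suffices. *)
move: (kn); rewrite leq_eqVlt => /predU1P[kE|klt].
  have aE2 : alpha = 2^-1.
    by apply: (mulIf (lt0r_neq0 (mulr_gt0 (ltr0n R 2) n0))); rewrite ak kE; field.
  exists (fun x => M * (x == 0)%:R); split=> [|x|a].
  - by rewrite eqxx mulr1.
  - by rewrite !inE negb_or => /andP[_ /negPf ->]; rewrite mulr0.
  have -> : cube_fourier R n (fun x => M * (x == 0)%:R) a = M.
    rewrite /cube_fourier (bigD1 0) //= big1 => [|x /negPf ->]; last by rewrite !mulr0.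
    by rewrite eqxx mulr1 addr0 cube_charC cube_char0 mul1r.
  have -> : M = 2 * 2 ^+ n.
    rewrite ME /u /v aE2 (_ : 1 - 2^-1 = 2^-1); last by lra.
    rewrite -mulrDl (_ : 2^-1 + 2^-1 = 1) ?mul1r; last by lra.
    by rewrite lnV ?posrE // mulrN opprK expRM_natl lnK ?posrE.
  by case: (a == 0); rewrite ?mulr1n ?mulr0n ?mulr_ge0 ?exprn_ge0 // ler_peMl ?exprn_ge0 // ler1n.
have a2 : alpha < 1 - alpha.
  have : (k%:R < n%:R :> R) by rewrite ltr_nat.
  rewrite -ak; nra.
(* [b^2 = alpha / (1 - alpha)] minimises [b^-k (1 + b^2)^n] and turns the required inequality into
   an equality. *)
pose b := expR (2^-1 * (u - v)).
apply: (@antiball_witness R n k b M kn).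
  rewrite expR_gt0 expR_lt1 pmulr_rlt0 ?invr_gt0 // subr_lt0 ltr_ln //.
have b2E : 1 + b ^+ 2 = expR (- v).
  rewrite /b -expRM_natl mulrA divff // mul1r expRB -aE -vE expRN -vE.
  by field; exact: lt0r_neq0.
rewrite b2E ME /b -!expRM_natl -mulrA -expRD ler_pM2l // ler_expR -ak.
by rewrite le_eqVlt; apply/orP; left; apply/eqP; field.
Qed.

Theorem theorem10p2 (R : realType) :
  exists c2 c3 : R, [/\ 0 < c2, 0 < c3 &
    forall n k : nat, (1 <= n)%N -> (1 <= k <= n)%N ->
    let q : R := 2 ^+ n in
    let alpha : R := k%:R / (2 * n%:R) in
    let beta : R :=
      - (alpha * log2 alpha + (1 - alpha) * log2 (1 - alpha)) in
    [/\ c2 * alpha `^ 4^-1 *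
          (alpha `^ alpha * (1 - alpha) `^ (1 - alpha)) ^+ n
          <= lambda R (cube_ball n k),
        c2 * alpha `^ 4^-1 *
          (alpha `^ alpha * (1 - alpha) `^ (1 - alpha)) ^+ n
          = c2 * alpha `^ 4^-1 * q `^ (- beta) &
        lambda R (cube_antiball n k)
          <= c3 * alpha `^ (- 4^-1) * q `^ (beta - 1)]].
Proof.
(* Both constants come from [M = 2 q^beta]. *)
exists 2^-1, 2; split=> // n k n1 kn q alpha beta.
have n0 : 0 < n%:R :> R by rewrite ltr0n.
have ak : alpha * (2 * n%:R) = k%:R.
  by rewrite divfK // gt_eqF // mulr_gt0.
have [lB lA] := lambda_cube_bounds R n k alpha kn ak.
move: kn => /andP[k1 kn].
have a0 : 0 < alpha by rewrite divr_gt0 ?mulr_gt0 ?ltr0n.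
have a1 : alpha <= 2^-1.
  have : (k%:R <= n%:R :> R) by rewrite ler_nat.
  rewrite -ak; nra.
have a1' : 0 < 1 - alpha by lra.
have q0 : 0 < q by rewrite exprn_gt0.
have l2 : ln 2 != 0 :> R by rewrite gt_eqF // ln_gt0 // ltr1n.
have qE : (alpha `^ alpha * (1 - alpha) `^ (1 - alpha)) ^+ n = q `^ (- beta).
  rewrite /powR !gt_eqF // -expRD -expRM_natl lnXn // /beta /log2.
  by congr expR; rewrite -[ln 2 *+ n]mulr_natl; field.
(* As [alpha <= 1], inserting the powers of [alpha] only weakens the bounds in [M]. *)
have a4 : alpha `^ 4^-1 <= 1.
  by rewrite -[leRHS](powRr0 alpha) ger_powR ?a0 ?invr_ge0 //=; lra.
have a4' : 1 <= alpha `^ (- 4^-1) by rewrite powRN invf_ge1 ?powR_gt0.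
rewrite qE in lB lA *; split=> //.
  apply: le_trans lB; rewrite invfM invrK ler_wpM2r ?powR_ge0 //.
  by rewrite ler_piMr // invr_ge0.
apply: le_trans lA _; rewrite -powRN opprK powRB; last first.
  by rewrite (gt_eqF q0) implybT.
rewrite powRr1 ?(ltW q0) // -!mulrA ler_wpM2l // ler_peMl //.
by rewrite divr_ge0 ?powR_ge0 // ltW.
Qed.
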